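(* Let $g:\mathbb{R}^n\to\mathbb{R}$ be defined by $g(z)=\alpha|a^\top z+b|$ with $a\in\mathbb{R}^n\setminus\{0\}$, $b\in\mathbb{R}$, $\alpha>0$. Then for all $x\in\mathbb{R}^n$, $$\mathrm{prox}_g(x)=x-\alpha\,\mathrm{Sat}_1\!\left(\frac{a^\top x+b}{\alpha\|a\|_2^2}\right)a.$$
   Context: The proximal operator of $f:\mathbb{R}^n\to\mathbb{R}$ is $\mathrm{prox}_f(x)=\operatorname*{arg\,min}_{z\in\mathbb{R}^n}\big[\tfrac12\|z-x\|_2^2+f(z)\big]$. For $\beta>0$, the saturation function $\mathrm{Sat}_\beta:\mathbb{R}\to\mathbb{R}$ is $\mathrm{Sat}_\beta(e)=\beta\,\mathrm{sign}(e)$ if $|e|>\beta$ and $\mathrm{Sat}_\beta(e)=e$ if $|e|\le\beta$. *)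

(* Defs.v *)
From mathcomp Require Import all_boot all_order all_algebra.
From mathcomp Require Import classical_sets reals.
Set Implicit Arguments.
Unset Strict Implicit.
Unset Printing Implicit Defensive.
Import Order.TTheory GRing.Theory Num.Theory.
Local Open Scope classical_set_scope.
Local Open Scope ring_scope.

(* The library norm `|x| on 'cV[R]_n is the sup norm, not the Euclidean one. *)
Definition norm2 (R : realType) (n : nat) (x : 'cV[R]_n) : R :=
  Num.sqrt (\sum_(i < n) x i 0 ^+ 2).

(* Set of all global minimizers, possibly empty; "arg min h = p" for a point p
   is the set equality argmin h = [set p] (p minimizes h and is the only
   minimizer). *)
Definition argmin (R : realType) (T : Type) (h : T -> R) : set T :=
  [set z | forall w : T, h z <= h w].

Definition prox (R : realType) (n : nat) (f : 'cV[R]_n -> R) (x : 'cV[R]_n) :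
    set 'cV[R]_n :=
  argmin (fun z : 'cV[R]_n => 2^-1 * norm2 (z - x) ^+ 2 + f z).

Definition Sat (R : realType) (beta e : R) : R :=
  if beta < `|e| then beta * Num.sg e else e.

(* Main.v *)
Require Import Defs.
From mathcomp Require Import all_boot all_order all_algebra.
From mathcomp Require Import classical_sets reals.
From mathcomp Require Import ring lra.
Import Order.TTheory GRing.Theory Num.Theory.
Local Open Scope classical_set_scope.
Local Open Scope ring_scope.

(** The objective defining the proximal point is 1-strongly convex, so a point
    [p] at which it has the subgradient 0 satisfies the quadratic growth bound
    [h p + ||z - p||^2 / 2 <= h z], and is therefore its only minimizer.  Since
    the subdifferential of [alpha * |.|] composed with an affine map is
    [alpha * s *: a], with [s] a subgradient of [|.|], optimality at
    [p = x - alpha * s *: a] means that [s] is a subgradient of [|.|] at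
    [a^T p + b = t - c * s], where [t = a^T x + b] and
    [c = alpha * ||a||^2].  The solution of this scalar inclusion is
    [s = Sat 1 (t / c)] ([Sat_fixed]); the growth bound then follows by
    expanding the square ([norm2_sqrD]) and bounding [|.|] below by its tangent
    of slope [s] ([prox_abs_affine_growth]). *)

Lemma norm2_sqr (R : realType) (n : nat) (u : 'cV[R]_n) :
  norm2 u ^+ 2 = (u^T *m u) 0 0.
Proof.
rewrite /norm2 sqr_sqrtr; last by apply: sumr_ge0 => i _; exact: sqr_ge0.
by rewrite mxE; apply: eq_bigr => i _; rewrite mxE expr2.
Qed.

Lemma norm2_sqr_gt0 (R : realType) (n : nat) (u : 'cV[R]_n) :
  u != 0 -> 0 < norm2 u ^+ 2.
Proof.
move=> u0; rewrite lt_def sqr_ge0 andbT; apply: contraNneq u0.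
rewrite norm2_sqr mxE => /eqP; rewrite psumr_eq0 => [/allP u0|i _]; last first.
  by rewrite mxE -expr2 sqr_ge0.
apply/eqP/matrixP => i j; rewrite ord1 mxE; apply/eqP.
by have := u0 i (mem_index_enum i); rewrite mxE -expr2 sqrf_eq0.
Qed.

Lemma norm2_sqrD (R : realType) (n : nat) (u v : 'cV[R]_n) :
  norm2 (u + v) ^+ 2 = norm2 u ^+ 2 + 2 * (u^T *m v) 0 0 + norm2 v ^+ 2.
Proof.
rewrite !norm2_sqr !mxE mulr_sumr -!big_split /=.
by apply: eq_bigr => i _; rewrite !mxE; ring.
Qed.

Lemma norm_Sat1_le1 (R : realType) (e : R) : `|Sat 1 e| <= 1.
Proof.
rewrite /Sat mul1r; case: ltP => // _.
by rewrite normr_sg; case: (e != 0).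
Qed.

(** [Sat 1 (t / c)] is a subgradient of [|.|] at [t - c * Sat 1 (t / c)]:
    where it saturates, the shifted point keeps the sign of [t]; elsewhere the
    shifted point is 0, where every slope in [[-1, 1]] is a subgradient. *)
Lemma Sat_fixed (R : realType) (t c : R) : 0 < c ->
  `|t - c * Sat 1 (t / c)| = Sat 1 (t / c) * (t - c * Sat 1 (t / c)).
Proof.
move=> c0; set e := t / c.
have -> : t = c * e by rewrite /e mulrC divfK ?gt_eqF.
rewrite -mulrBr /Sat mul1r; case: ltP => [|_]; last by rewrite subrr mulr0 normr0 mulr0.
rewrite lter_normr => /orP[] he.
  rewrite gtr0_sg; last by lra.
  by rewrite ger0_norm ?mul1r // mulr_ge0 ?ltW // subr_gt0.
rewrite ltr0_sg; last by lra.
by rewrite ler0_norm ?mulN1r // mulr_ge0_le0 ?ltW //; lra.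
Qed.

(** The error term is required to be positive away from [p], which is what
    gives uniqueness of the minimizer as well as optimality. *)
Lemma argmin_growth (R : realType) (T : Type) (h d : T -> R) (p : T) :
  (forall z, 0 <= d z) -> (forall z, d z = 0 -> z = p) ->
  (forall z, h p + d z <= h z) -> argmin h = [set p].
Proof.
move=> d0 dp hp; apply/seteqP; split => z /=; last first.
  by move=> -> w; apply: le_trans (hp w); rewrite lerDl.
move=> zmin; apply: dp; apply/eqP; rewrite eq_le d0 andbT.
by have := hp z; have := zmin p; lra.
Qed.

(** No convex calculus is needed: the two conditions on [s] say exactly that the
    line through the origin of slope [s] lies below [|.|] and touches it at
    [a^T p + b], and the quadratic term is expanded exactly around [p]. *)
Lemma prox_abs_affine_growth (R : realType) (n : nat) (a x z : 'cV[R]_n)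
    (b alpha s : R) (p := x - (alpha * s) *: a) :
  0 <= alpha -> `|s| <= 1 ->
  `|(a^T *m p) 0 0 + b| = s * ((a^T *m p) 0 0 + b) ->
  2^-1 * norm2 (p - x) ^+ 2 + alpha * `|(a^T *m p) 0 0 + b|
    + 2^-1 * norm2 (z - p) ^+ 2
  <= 2^-1 * norm2 (z - x) ^+ 2 + alpha * `|(a^T *m z) 0 0 + b|.
Proof.
move=> alpha0 s1 ->.
have px : p - x = - (alpha * s) *: a by rewrite /p addrAC subrr add0r scaleNr.
have -> : z - x = (p - x) + (z - p) by rewrite [RHS]addrC addrA subrK.
rewrite (norm2_sqrD _ _ (p - x)).
(* The cross term of the square is the slope of the tangent of the absolute
   value, so the two cancel. *)
have -> : ((p - x)^T *m (z - p)) 0 0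
    = - (alpha * s) * ((a^T *m z) 0 0 - (a^T *m p) 0 0).
  by rewrite px linearZ /= -scalemxAl mulmxBr !mxE.
have tangent y : alpha * (s * y) <= alpha * `|y|.
  rewrite ler_wpM2l //; apply: le_trans (ler_norm _) _.
  by rewrite normrM ler_piMl.
by have := tangent ((a^T *m z) 0 0 + b); lra.
Qed.

Theorem lemma8 (R : realType) (n : nat) (a : 'cV[R]_n) (b alpha : R)
    (ha : a != 0) (halpha : 0 < alpha) (g : 'cV[R]_n -> R)
    (hg : forall z : 'cV[R]_n, g z = alpha * `|(a^T *m z) 0 0 + b|)
    (x : 'cV[R]_n) :
  prox g x =
    [set x - (alpha * Sat 1 (((a^T *m x) 0 0 + b) / (alpha * norm2 a ^+ 2))) *: a].
Proof.
set c := alpha * norm2 a ^+ 2; set t := (a^T *m x) 0 0 + b.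
set s := Sat 1 (t / c); set p := x - _ *: a.
have c0 : 0 < c by rewrite mulr_gt0 // norm2_sqr_gt0.
have tp : (a^T *m p) 0 0 + b = t - c * s.
  have -> : (a^T *m p) 0 0 = (a^T *m x) 0 0 - alpha * s * norm2 a ^+ 2.
    by rewrite norm2_sqr mulmxBr -scalemxAr mxE; congr (_ + _); rewrite !mxE.
  by rewrite /t /c; ring.
apply: (@argmin_growth _ _ _ (fun z => 2^-1 * norm2 (z - p) ^+ 2)) => z.
- by rewrite mulr_ge0 ?invr_ge0 ?sqr_ge0.
- move=> /eqP; rewrite mulf_eq0 invr_eq0 pnatr_eq0 /= => zp.
  apply/eqP; rewrite -subr_eq0; apply: contraTT zp => /norm2_sqr_gt0.
  by rewrite lt_def => /andP[].
- rewrite !hg; apply: prox_abs_affine_growth; first exact: ltW.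
    exact: norm_Sat1_le1.
  by rewrite -/p tp; exact: Sat_fixed.
Qed.
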